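(* For every $n\in\mathbb{N}$, the graph $G(5,n)$ is connected and has diameter at most $3$.
   Context: For a prime $p$ and $n\in\mathbb{N}$, $G(p,n)$ is the simple graph with vertex set $\{2,4,\ldots,2n\}$ in which two distinct vertices $a,b$ are adjacent if and only if both $\frac{a+b}{2}$ and $\frac{|a-b|}{2}$ are odd positive integers neither of which equals $pk$ for an integer $k\ge 2$. *)

(* Defs.v *)
From mathcomp Require Import all_boot.
From mathcomp Require Import ssralg ssrint.
Import IntDist.

Set Implicit Arguments.
Unset Strict Implicit.
Unset Printing Implicit Defensive.

Definition simple_graph (T : finType) (e : rel T) : Prop :=
  symmetric e /\ irreflexive e.

Definition graph_connected (T : finType) (e : rel T) : Prop :=
  forall u v : T, connect e u v.

Definition walk_of_length (T : finType) (e : rel T) (u v : T) (k : nat) : bool :=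
  [exists w : k.-tuple T, path e u w && (last u w == v)].

(* If some walk joins u to v then a shortest one has length < #|T|, so the      *)
(* search is exhaustive (see gdistP). Otherwise [find] returns #|T|, a value no *)
(* genuine distance takes, standing for infinity.                               *)
Definition gdist (T : finType) (e : rel T) (u v : T) : nat :=
  find (walk_of_length e u v) (iota 0 #|T|).

(* Meaningful for connected graphs only, by the convention in gdist. *)
Definition diameter (T : finType) (e : rel T) : nat :=
  \max_(u : T) \max_(v : T) gdist e u v.

Lemma walk_of_lengthP (T : finType) (e : rel T) (u v : T) (k : nat) :
  reflect (exists w : seq T, [/\ size w = k, path e u w & last u w = v])
          (walk_of_length e u v k).
Proof.
apply: (iffP existsP) => [[w /andP[pw /eqP lw]]|[w [sw pw lw]]].
  by exists w; rewrite size_tuple.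
by exists (Tuple (introT eqP sw)); rewrite /= pw lw eqxx.
Qed.

Lemma gdistP (T : finType) (e : rel T) (u v : T) :
  connect e u v ->
  walk_of_length e u v (gdist e u v) /\
  (forall k, walk_of_length e u v k -> gdist e u v <= k).
Proof.
move=> /connectP[w0 pw0 lw0]; rewrite /gdist; set a := walk_of_length e u v.
have ha : has a (iota 0 #|T|).
  case/shortenP: pw0 lw0 => w pw uw _ lw; apply/hasP; exists (size w).
    by rewrite mem_iota /= add0n; have := max_card (mem (u :: w));
       rewrite (card_uniqP uw).
  by apply/walk_of_lengthP; exists w.
have lt : find a (iota 0 #|T|) < #|T| by rewrite -{2}(size_iota 0 #|T|) -has_find.
split=> [|k ak]; first by have := nth_find 0 ha; rewrite nth_iota.
rewrite leqNgt; apply/negP => kf.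
by have := before_find 0 kf; rewrite nth_iota ?add0n ?ak // (ltn_trans kf).
Qed.

(* m = p * k for some integer k >= 2; for m > 0 such a k is at most m. *)
Definition proper_multiple (p m : nat) : bool :=
  [exists k : 'I_m.+1, (2 <= k) && (m == p * k)].

Lemma proper_multipleP (p m : nat) :
  0 < p -> reflect (exists2 k, 2 <= k & m = p * k) (proper_multiple p m).
Proof.
move=> p0; apply: (iffP existsP) => [[k /andP[k2 /eqP mk]]|[k k2 mk]].
  by exists k.
have km : k < m.+1 by rewrite ltnS mk leq_pmull.
by exists (Ordinal km); rewrite /= k2 mk eqxx.
Qed.

(* The set {2, 4, ..., 2n}. *)
Definition vertex (n : nat) : finType :=
  {a : 'I_(2 * n).+1 | (0 < a) && ~~ odd a}.

Definition label (n : nat) (a : vertex n) : nat := val (val a).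

(* Labels are even, so both divisions by 2 are exact; an odd natural number is  *)
(* automatically positive.                                                      *)
Definition G (p n : nat) : rel (vertex n) := fun a b =>
  let s := (label a + label b) %/ 2 in
  let d := `|label a - label b| %/ 2 in
  [&& a != b, odd s, odd d, ~~ proper_multiple p s & ~~ proper_multiple p d].

Lemma G_simple (p n : nat) : simple_graph (@G p n).
Proof.
split=> [a b|a]; last by rewrite /G eqxx.
by rewrite /G eq_sym addnC distnC.
Qed.

Lemma label_vertex (n m : nat) :
  (exists a : vertex n, label a = m) <-> (exists2 i, 1 <= i <= n & m = 2 * i).
Proof.
split=> [[[[a la] aP] <-]|[i /andP[i1 i_n] ->]].
  have /= /andP[a0 oa] := aP.
  exists a./2; rewrite /label /=; last by rewrite mul2n even_halfK.
  move: a0 (la); rewrite -(even_halfK oa) doubleK -mul2n ltnS leq_pmul2l //.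
  by rewrite muln_gt0 /= => -> ->.
have lt : 2 * i < (2 * n).+1 by rewrite ltnS leq_pmul2l.
have P : (0 < Ordinal lt) && ~~ odd (Ordinal lt).
  by rewrite /= muln_gt0 i1 mul2n odd_double.
by exists (exist _ (Ordinal lt) P).
Qed.

(* Main.v *)
Require Import Defs.
From mathcomp Require Import all_boot.
From mathcomp Require Import ssrint zify.
Import IntDist.

(** Halve all labels, so that the vertices are 1, ..., n.  Two vertices of
    opposite parity whose squares differ modulo 5 are adjacent, since then 5
    divides neither their sum nor their difference.  This sufficient condition
    only depends on residues modulo 10, so as soon as n >= 10 a walk of length at
    most 3 between any two vertices can be found, with its inner vertices in
    {1, ..., 10}, by inspecting the residues of its ends.  The remaining n < 10
    are finitely many graphs; there the exception made for p itself matters. *)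

Lemma connected_short_walks (T : finType) (e : rel T) (k : nat) :
  (forall u v, exists w, [/\ size w <= k, path e u w & last u w = v]) ->
  graph_connected e.
Proof. by move=> short u v; have [w [_ ew <-]] := short u v; apply/connectP; exists w. Qed.

Lemma diameter_short_walks (T : finType) (e : rel T) (k : nat) :
  (forall u v, exists w, [/\ size w <= k, path e u w & last u w = v]) ->
  diameter e <= k.
Proof.
move=> short; apply/bigmax_leqP => u _; apply/bigmax_leqP => v _.
have [w [wk ew lw]] := short u v.
have [_ min_dist] := gdistP (connected_short_walks _ _ _ short u v).
by apply: leq_trans wk; apply: min_dist; apply/walk_of_lengthP; exists w.
Qed.

(** A boolean search, so that finite ranges of ends can be settled by computation. The relation [r]
    is a parameter because it will be [residue_adj] for n >= 10 and [half_adj 5] for n < 10. *)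
Definition three_step (r : rel nat) (s : seq nat) (i j : nat) : bool :=
  [|| r i j, has (fun x => r i x && r x j) s |
      has (fun x => r i x && has (fun y => r x y && r y j) s) s].

(* [i - j + (j - i)] is the absolute difference, one of the truncated terms being 0. *)
Definition half_adj (p : nat) : rel nat := fun i j =>
  all (fun m => odd m && ((m == p) || ~~ (p %| m))) [:: i + j; i - j + (j - i)].

Lemma proper_multipleN (p m : nat) :
  0 < p -> (m == p) || ~~ (p %| m) -> ~~ proper_multiple p m.
Proof.
move=> p_gt0 ok_m; apply/(proper_multipleP _ p_gt0) => -[k k2 mE]; move: ok_m.
by rewrite {m}mE dvdn_mulr // orbF -{2}[p]muln1 eqn_pmul2l // gtn_eqF.
Qed.

Lemma label_inj (n : nat) : injective (@label n).
Proof. by move=> a b /val_inj/val_inj. Qed.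

Lemma half_adj_G (p n i j : nat) (a b : vertex n) :
  0 < p -> label a = 2 * i -> label b = 2 * j -> half_adj p i j -> G p a b.
Proof.
move=> p_gt0 ai bj /and3P[/andP[os ps] /andP[od pd] _].
have -> : G p a b = [&& a != b, odd (i + j), odd (i - j + (j - i)),
    ~~ proper_multiple p (i + j) & ~~ proper_multiple p (i - j + (j - i))].
  rewrite /G ai bj; have -> : (2 * i + 2 * j) %/ 2 = i + j by lia.
  by have -> : `|2 * i - 2 * j| %/ 2 = i - j + (j - i) by lia.
(* An odd difference is nonzero, which gives [a != b]. *)
rewrite os od !proper_multipleN // !andbT; apply/eqP => ab.
by move: od ai; rewrite ab bj; lia.
Qed.

Lemma three_step_G (p n : nat) (r : rel nat) (s : seq nat) (i j : nat) (u v : vertex n) :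
  0 < p -> subrel r (half_adj p) -> {in s, forall x, 1 <= x <= n} ->
  label u = 2 * i -> label v = 2 * j -> three_step r s i j ->
  exists w, [/\ size w <= 3, path (@G p n) u w & last u w = v].
Proof.
move=> p_gt0 r_adj s_n ui vj.
have rG (x y : nat) (a b : vertex n) :
    label a = 2 * x -> label b = 2 * y -> r x y -> G p a b.
  by move=> ax by_ /r_adj; apply: half_adj_G.
have lift x : x \in s -> exists a : vertex n, label a = 2 * x.
  by move=> /s_n x_n; apply/label_vertex; exists x.
case/or3P.
- by move=> rij; exists [:: v]; rewrite /= (rG i j u v).
- case/hasP=> x /lift[a ax] /andP[rix rxj]; exists [:: a; v].
  by rewrite /= (rG i x u a) ?(rG x j a v).
case/hasP=> x /lift[a ax] /andP[rix /hasP[y /lift[b by_] /andP[rxy ryj]]].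
by exists [:: a; b; v]; rewrite /= (rG i x u a) ?(rG x y a b) ?(rG y j b v).
Qed.

Definition residue_adj : rel nat := fun i j =>
  (odd i != odd j) && (i ^ 2 != j ^ 2 %[mod 5]).

Lemma residue_adj_half_adj : subrel residue_adj (half_adj 5).
Proof.
(* Both relations are symmetric; once j <= i, the truncated difference is the true one and i^2 - j^2
   factors as (i - j)(i + j). *)
move=> i j; wlog le_ji : i j / j <= i => [hw|].
  case/orP: (leq_total j i) => [/hw//|le_ij].
  rewrite /residue_adj eq_sym [i ^ 2 == _ %[mod 5]]eq_sym => /(hw _ _ le_ij).
  by rewrite /half_adj addnC [_ - _ + _]addnC.
case/andP=> odd_ij; rewrite eqn_mod_dvd ?leq_sqr // subn_sqr => ndvd.
have nd_sum : ~~ (5 %| i + j) by apply: contra ndvd => /dvdn_mull->.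
have nd_diff : ~~ (5 %| i - j + (j - i)).
  by rewrite (eqP le_ji) addn0; apply: contra ndvd => /dvdn_mulr->.
by rewrite /half_adj /= nd_sum nd_diff !orbT; lia.
Qed.

Lemma residue_adj_mod (i j : nat) : residue_adj (i %% 10) (j %% 10) = residue_adj i j.
Proof.
have oddE x : odd (x %% 10) = odd x by lia.
have sqrE x : (x %% 10) ^ 2 = x ^ 2 %[mod 5].
  by rewrite -modnXm (@modn_dvdm 10) // modnXm.
by rewrite /residue_adj !oddE !sqrE.
Qed.

(** Only the ends are reduced modulo 10: inner points must stay halved labels, so residue 0 occurs
    among them as 10. Equal residues are checked too, since distinct ends may be congruent. *)
Lemma three_step_residue (i j : nat) : three_step residue_adj (iota 1 10) i j.
Proof.
have -> : three_step residue_adj (iota 1 10) i j =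
          three_step residue_adj (iota 1 10) (i %% 10) (j %% 10).
  have rl x : residue_adj (i %% 10) x = residue_adj i x.
    by rewrite -residue_adj_mod modn_mod residue_adj_mod.
  have rr x : residue_adj x (j %% 10) = residue_adj x j.
    by rewrite -residue_adj_mod modn_mod residue_adj_mod.
  rewrite /three_step rl rr; congr [|| _, _ | _]; apply: eq_has => x.
    by rewrite rl rr.
  by rewrite rl; congr (_ && _); apply: eq_has => y; rewrite rr.
have /allP res : all (fun x => all (three_step residue_adj (iota 1 10) x) (iota 0 10))
                     (iota 0 10) by vm_compute.
have mem x : x %% 10 \in iota 0 10 by rewrite mem_iota ltn_mod.
by apply: (allP (res _ (mem i))).
Qed.

(** Here [residue_adj] would be too strict: for n = 3 the only neighbour of 3 is 2, with sum 5
    itself. The ends are distinct because for n = 1 there is no walk of positive length. *)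
Lemma three_step_small (n i j : nat) :
  n < 10 -> i \in iota 1 n -> j \in iota 1 n -> i != j ->
  three_step (half_adj 5) (iota 1 n) i j.
Proof.
move=> n_lt i_n j_n; apply/implyP.
have /allP small : all (fun n => all (fun i => all (fun j =>
    (i != j) ==> three_step (half_adj 5) (iota 1 n) i j) (iota 1 n)) (iota 1 n))
    (iota 0 10) by vm_compute.
by apply: (allP (allP (small n _) i i_n) j j_n); rewrite mem_iota.
Qed.

Theorem theorem5p4 (n : nat) :
  graph_connected (@G 5 n) /\ diameter (@G 5 n) <= 3.
Proof.
suff short (u v : vertex n) :
    exists w, [/\ size w <= 3, path (@G 5 n) u w & last u w = v].
  by split; [apply: connected_short_walks short | apply: diameter_short_walks].
have [i i_n ui] := (label_vertex n (label u)).1 (ex_intro _ u erefl).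
have [j j_n vj] := (label_vertex n (label v)).1 (ex_intro _ v erefl).
(* [three_step] does not count the empty walk, so equal ends are handled apart. *)
have [ij|neq_ij] := eqVneq i j.
  by exists [::]; split=> //; apply: label_inj; rewrite ui vj ij.
have [n_ge|n_lt] := leqP 10 n.
  apply: (three_step_G 5 n residue_adj (iota 1 10) i j) => //; last first.
  - exact: three_step_residue.
  - by move=> x; rewrite mem_iota => /andP[-> x_le]; apply: leq_trans n_ge.
  exact: residue_adj_half_adj.
apply: (three_step_G 5 n (half_adj 5) (iota 1 n) i j) => // [x|].
  by rewrite mem_iota.
by apply: three_step_small; rewrite ?mem_iota.
Qed.
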